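(* Let $\mathrm{R}^{\mathrm{Gr}}\colon\mathrm{T}\,\mathrm{Gr}(n,n-r)\to\mathrm{Gr}(n,n-r)$ be a smooth map, with $\mathrm{R}^{\mathrm{Gr}}_P$ its restriction to $\mathrm{T}_P\mathrm{Gr}(n,n-r)$, and define $\mathrm{R}\colon\mathrm{T}\mathcal{M}\to\mathcal{M}$ by $$\mathrm{R}_{(X,P)}(\dot X,\dot P)=\big((X+\dot X)(I-\bar P),\ \bar P\big),\qquad \bar P=\mathrm{R}^{\mathrm{Gr}}_P(\dot P).$$ Then $\mathrm{R}$ is a retraction on $\mathcal{M}$ if and only if $\mathrm{R}^{\mathrm{Gr}}$ is a retraction on $\mathrm{Gr}(n,n-r)$.
   Context: Let $m,n,r$ be positive integers with $r<\min(m,n)$. Let $\mathrm{Sym}(n)$ be the space of real symmetric $n\times n$ matrices. $\mathrm{Gr}(n,n-r)=\{P\in\mathrm{Sym}(n): P^2=P,\ \mathrm{rank}\,P=n-r\}$ is an embedded submanifold of $\mathrm{Sym}(n)$. The desingularization $\mathcal{M}=\{(X,P)\in\mathbb{R}^{m\times n}\times\mathrm{Gr}(n,n-r): XP=0\}$ is a smooth embedded submanifold of $\mathbb{R}^{m\times n}\times\mathrm{Sym}(n)$ of dimension $(m+n-r)r$. A retraction on a smooth manifold $\mathcal{N}$ is a smooth map $\mathrm{R}\colon\mathrm{T}\mathcal{N}\to\mathcal{N}$ (with $\mathrm{R}_x$ its restriction to $\mathrm{T}_x\mathcal{N}$) such that for every $x\in\mathcal{N}$ and $v\in\mathrm{T}_x\mathcal{N}$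 the curve $c(t)=\mathrm{R}_x(tv)$ satisfies $c(0)=x$ and $c'(0)=v$. *)

(* Defs.v *)
From HB Require Import structures.
From mathcomp Require Import all_boot all_order all_algebra.
From mathcomp Require Import all_classical all_reals all_analysis.

Set Implicit Arguments.
Unset Strict Implicit.
Unset Printing Implicit Defensive.

Import Order.TTheory GRing.Theory Num.Theory.
Import numFieldNormedType.Exports.

Local Open Scope classical_set_scope.
Local Open Scope ring_scope.

(* f is of class C^k on the open set U. The derivative of f is tested against
   each fixed direction v; in finite dimension (the only case used) this is the
   same as asking that x |-> 'd f x, valued in linear maps, be of class C^k. *)
Fixpoint class_C (R : realType) (V W : normedModType R) (k : nat)
    (U : set V) (f : V -> W) : Prop :=
  if k is k'.+1 then
    (forall x, U x -> differentiable f x) /\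
    (forall v, class_C k' U (fun x => 'D_v f x))
  else forall x, U x -> {for x, continuous f}.

Definition smooth_on (R : realType) (V W : normedModType R)
    (U : set V) (f : V -> W) : Prop :=
  forall k, class_C k U f.

(* Smooth maps between embedded submanifolds A of V and B of W: the map is the
   restriction to A of f, whose values outside A are irrelevant, and near each
   point of A it extends to a smooth map on an open subset of V. *)
Definition smooth_map (R : realType) (V W : normedModType R)
    (A : set V) (B : set W) (f : V -> W) : Prop :=
  (forall x, A x -> B (f x)) /\
  (forall x, A x -> exists (U : set V) (g : V -> W),
     [/\ open_nbhs x U, smooth_on U g &
         forall y, (A `&` U) y -> g y = f y]).

(* Velocities at x of the smooth curves lying in the embedded submanifold N. *)
Definition tangent_space (R : realType) (V : normedModType R)
    (N : set V) (x : V) : set V :=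
  [set v | exists (e : R) (c : R -> V),
     [/\ 0 < e, smooth_on `]- e, e[ c,
         forall t, t \in `]- e, e[ -> N (c t),
         c 0 = x & is_derive (0 : R) (1 : R) c v]].

Definition tangent_bundle (R : realType) (V : normedModType R)
    (N : set V) : set (V * V) :=
  [set z | N z.1 /\ tangent_space N z.1 z.2].

Definition is_retraction (R : realType) (V : normedModType R)
    (N : set V) (f : V * V -> V) : Prop :=
  smooth_map (tangent_bundle N) N f /\
  (forall x v, N x -> tangent_space N x v ->
     let c := fun t : R => f (x, t *: v) in
     c 0 = x /\ is_derive (0 : R) (1 : R) c v).

(* Gr and M are sets of matrices in 'M_n rather than in Sym(n): a locally
   defined smooth map on Sym(n) extends to 'M_n through P |-> (P + P^T) / 2, so
   smoothness and tangent vectors are the same in both ambient spaces. *)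
Definition Gr (R : realType) (n k : nat) : set 'M[R]_n :=
  [set P | [/\ P^T = P, P *m P = P & \rank P = k]].

Arguments Gr R n k : clear implicits.

Definition desing (R : realType) (m n r : nat) : set ('M[R]_(m, n) * 'M[R]_n) :=
  [set z | Gr R n (n - r) z.2 /\ z.1 *m z.2 = 0].

Arguments desing R m n r : clear implicits.

Definition desing_map (R : realType) (m n : nat)
    (RGr : 'M[R]_n * 'M[R]_n -> 'M[R]_n)
    (z : ('M[R]_(m, n) * 'M[R]_n) * ('M[R]_(m, n) * 'M[R]_n)) :
    'M[R]_(m, n) * 'M[R]_n :=
  let: ((X, P), (dX, dP)) := z in
  let Pbar := RGr (P, dP) in
  ((X + dX) *m (1%:M - Pbar), Pbar).

(* Main.v *)
Require Import Defs.
From HB Require Import structures.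
From mathcomp Require Import all_boot all_order all_algebra.
From mathcomp Require Import all_classical all_reals all_analysis.
Import numFieldNormedType.Exports.
Local Open Scope ring_scope.

Set Implicit Arguments.
Unset Strict Implicit.
Unset Printing Implicit Defensive.

Import Order.TTheory GRing.Theory Num.Theory.
Local Open Scope classical_set_scope.

(* With c(t) = R^Gr_P(t dP), the first component of R_(X,P)(t (dX, dP)) is
   (X + t dX)(I - c(t)), of derivative dX (I - P) - X dP at t = 0 when R^Gr is a
   retraction. This equals dX because differentiating X P = 0 along a curve in M
   gives dX P + X dP = 0. Conversely, the second component of R along the tangent
   vectors (0, dP) at (0, P) is R^Gr. *)

(** * Chain, pairing and product rules for directional derivatives *)

Section differential_calculus.
Context {R : realType}.
Implicit Types V W Z Y : normedModType R.

(** The difference [h] of the two maps vanishes near [x], so it is differentiable there with zero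
    differential, and [g] is [f + h]. *)
Lemma near_eq_differentiable V W (f g : V -> W) (x : V) :
  (\near x, f x = g x) -> differentiable f x -> differentiable g x.
Proof.
move=> fg df; pose h := g - f.
have hx0 : h x = 0 by rewrite /h !fctE (nbhs_singleton fg) subrr.
have ho : h \o shift x =
    cst (h x) + (\0 : {linear V -> W}) +o_ (0 : V) (id : V -> V).
  apply/eqaddoP => e e0; rewrite hx0.
  have : \forall y \near (0 : V), f (y + x) = g (y + x).
    by move: fg; rewrite (near_shift 0 x); apply: filterS => y; rewrite /= subr0.
  apply: filterS => y fgy.
  rewrite !fctE /= /h !fctE fgy subrr addr0 subr0 normr0.
  exact: mulr_ge0 (ltW e0) (normr_ge0 _).
(* [ho] is a first-order expansion with zero linear part; by uniqueness of the differential, that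
   part is ['d h x]. *)
have dh : differentiable h x.
  have c0 : continuous (\0 : {linear V -> W}) by move=> ?; exact: cst_continuous.
  apply/diff_locallyP; rewrite (diff_unique c0 ho); split => //.
have -> : g = f + h by rewrite /h addrC subrK.
exact: differentiableD.
Qed.

Lemma derive_comp_linear V W Z (f : V -> W) (L : {linear W -> Z}) x v :
  continuous L -> differentiable f x -> 'D_v (L \o f) x = L ('D_v f x).
Proof.
move=> cL df.
have dL : differentiable L (f x) by exact: linear_differentiable.
rewrite !deriveE //; last exact: differentiable_comp.
by rewrite diff_comp //= diff_lin.
Qed.

Lemma derive_pair V W Z (f : V -> W) (g : V -> Z) x v :
  differentiable f x -> differentiable g x ->
  'D_v (fun y => (f y, g y)) x = ('D_v f x, 'D_v g x).
Proof.
move=> df dg; rewrite !deriveE ?diff_pair //; exact: differentiable_pair.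
Qed.

Lemma differentiable_bilinear Y V W Z (B : {bilinear Y -> V -> W})
    (f : Z -> Y) (g : Z -> V) x :
  continuous (fun p => B p.1 p.2) ->
  differentiable f x -> differentiable g x ->
  differentiable (fun y => B (f y) (g y)) x.
Proof.
move=> cB df dg.
have -> : (fun y => B (f y) (g y)) =
  (fun p => B p.1 p.2) \o (fun y => (f y, g y)) by [].
apply: differentiable_comp; first exact: differentiable_pair.
exact: differentiable_bilin.
Qed.

Lemma derive_bilinear Y V W Z (B : {bilinear Y -> V -> W})
    (f : Z -> Y) (g : Z -> V) x v :
  continuous (fun p => B p.1 p.2) ->
  differentiable f x -> differentiable g x ->
  'D_v (fun y => B (f y) (g y)) x = B (f x) ('D_v g x) + B ('D_v f x) (g x).
Proof.
move=> cB df dg.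
rewrite !deriveE //; last exact: differentiable_bilinear.
have -> : (fun y => B (f y) (g y)) =
  (fun p => B p.1 p.2) \o (fun y => (f y, g y)) by [].
have dp : differentiable (fun y => (f y, g y)) x by exact: differentiable_pair.
rewrite diff_comp //; last exact: differentiable_bilin.
by rewrite /= diff_bilin // diff_pair.
Qed.

(** The two difference quotients coincide, since L (h v + x) = h L v + L x. *)
Lemma derive_precomp_linear V W Z (f : W -> Z) (L : {linear V -> W}) x v :
  'D_v (f \o L) x = 'D_(L v) f (L x).
Proof.
by rewrite /derive; under eq_fun do rewrite /= linearP.
Qed.

End differential_calculus.

(** * Closure properties of maps of class C^k *)

Section class_C.
Context {R : realType}.
Implicit Types V W Z Y : normedModType R.

Lemma class_CW V W k (U : set V) (f : V -> W) :
  class_C k.+1 U f -> class_C k U f.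
Proof.
elim: k f => [|k IH] f.
  by move=> [df _] x Ux; exact/differentiable_continuous/df.
by move=> [df Df]; split => // v; apply: IH; exact: Df.
Qed.

(** As [U] is open, equality on [U] is equality near each of its points, which fixes the
    derivatives. The inductions below need this because their derivative formulas are only known on
    [U]. *)
Lemma class_C_eq V W k (U : set V) (f g : V -> W) : open U ->
  (forall x, U x -> f x = g x) -> class_C k U f -> class_C k U g.
Proof.
move=> oU; elim: k f g => [|k IH] f g fg.
  move=> cf x Ux.
  have fgx : \near x, f x = g x by near=> y; apply: fg; near: y; exact: open_nbhs_nbhs.
  have cfx : f y @[y --> x] --> f x := cf x Ux.
  suff : g y @[y --> x] --> g x by [].
  by rewrite -(fg x Ux); apply: cvg_trans cfx; exact: near_eq_cvg.
move=> [df Df].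
have fgx x : U x -> \near x, f x = g x.
  by move=> Ux; near=> y; apply: fg; near: y; exact: open_nbhs_nbhs.
split => [x Ux|v]; first exact: near_eq_differentiable (fgx x Ux) (df x Ux).
apply: IH (Df v) => x Ux; exact: near_eq_derive (fgx x Ux).
Unshelve. all: by end_near. Qed.

Lemma class_C_comp_linear V W Z k (U : set V) (L : {linear W -> Z})
    (f : V -> W) :
  continuous L -> open U -> class_C k U f -> class_C k U (L \o f).
Proof.
move=> cL oU; elim: k f => [|k IH] f.
  by move=> cf x Ux; apply: continuous_comp (cf x Ux) _; exact: cL.
move=> [df Df]; split => [x Ux|v].
  by apply: differentiable_comp (df x Ux) _; exact: linear_differentiable.
apply: class_C_eq (IH _ (Df v)) => // x Ux.
by rewrite [RHS]derive_comp_linear//; exact: df.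
Qed.

(** The induction closes because the derivative of [f \o L] along [v] is again a composite with [L],
    namely that of the derivative of [f] along [L v]. *)
Lemma class_C_precomp_linear V W Z k (U : set W) (L : {linear V -> W})
    (f : W -> Z) :
  continuous L -> class_C k U f -> class_C k (L @^-1` U) (f \o L).
Proof.
move=> cL; elim: k f => [|k IH] f.
  by move=> cf x Ux; apply: continuous_comp (cL x) (cf _ Ux).
move=> [df Df]; split => [x Ux|v].
  by apply: differentiable_comp (df _ Ux); exact: linear_differentiable.
have -> : (fun x => 'D_v (f \o L) x) = (fun y => 'D_(L v) f y) \o L.
  by apply/funext => x; exact: derive_precomp_linear.
exact: IH (Df (L v)).
Qed.

Lemma class_C_cst V W k (U : set V) (a : W) : class_C k U (fun=> a).
Proof.
elim: k a => [|k IH] a; first by move=> x _; exact: cst_continuous.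
split=> [x _|v]; first exact: differentiable_cst.
by under eq_fun do rewrite derive_cst.
Qed.

Lemma class_C_linear V W k (U : set V) (L : {linear V -> W}) :
  continuous L -> class_C k U L.
Proof.
move=> cL; case: k => [|k]; first by move=> x _; exact: cL.
split=> [x _|v]; first exact: linear_differentiable.
have -> : (fun x => 'D_v L x) = (fun=> L v); last exact: class_C_cst.
by apply/funext => x; rewrite deriveE ?diff_lin//; exact: linear_differentiable.
Qed.

Lemma class_CD V W k (U : set V) (f g : V -> W) : open U ->
  class_C k U f -> class_C k U g -> class_C k U (f \+ g).
Proof.
move=> oU; elim: k f g => [|k IH] f g.
  by move=> cf cg x Ux; apply: continuousD; [exact: cf|exact: cg].
move=> [df Df] [dg Dg]; split => [x Ux|v].
  by apply: differentiableD; [exact: df|exact: dg].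
apply: class_C_eq (IH _ _ (Df v) (Dg v)) => // x Ux /=.
by rewrite deriveD//; apply: diff_derivable; [exact: df|exact: dg].
Qed.

Lemma class_C_pair V W Z k (U : set V) (f : V -> W) (g : V -> Z) : open U ->
  class_C k U f -> class_C k U g -> class_C k U (fun x => (f x, g x)).
Proof.
move=> oU; elim: k f g => [|k IH] f g.
  by move=> cf cg x Ux; apply: cvg_pair; [exact: cf|exact: cg].
move=> [df Df] [dg Dg]; split => [x Ux|v].
  by apply: differentiable_pair; [exact: df|exact: dg].
apply: class_C_eq (IH _ _ (Df v) (Dg v)) => // x Ux /=.
by rewrite derive_pair//; [exact: df|exact: dg].
Qed.

Lemma class_C_bilinear V W Z Y k (U : set V) (B : {bilinear W -> Z -> Y})
    (f : V -> W) (g : V -> Z) :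
  continuous (fun p => B p.1 p.2) -> open U ->
  class_C k U f -> class_C k U g -> class_C k U (fun x => B (f x) (g x)).
Proof.
move=> cB oU; elim: k f g => [|k IH] f g.
  move=> cf cg x Ux.
  apply: (@continuous_comp _ _ _ (fun x => (f x, g x)) (fun p => B p.1 p.2)).
    by apply: cvg_pair; [exact: cf|exact: cg].
  exact: cB.
move=> Cf Cg; have [df Df] := Cf; have [dg Dg] := Cg; split => [x Ux|v].
  by apply: differentiable_bilinear => //; [exact: df|exact: dg].
(* Each term of the Leibniz rule keeps one factor undifferentiated; that factor is lowered to class
   C^k so that the induction hypothesis applies. *)
have Cf' := class_CW Cf; have Cg' := class_CW Cg.
apply: class_C_eq (class_CD oU (IH _ _ Cf' (Dg v)) (IH _ _ (Df v) Cg')) => //.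
by move=> x Ux /=; rewrite derive_bilinear//; [exact: df|exact: dg].
Qed.

End class_C.

(** * Continuity of the matrix product, entry by entry *)

Lemma cvg_mx (R : realType) m n (T : Type) (F : set_system T) {FF : Filter F}
    (f : T -> 'M[R]_(m, n)) (A : 'M[R]_(m, n)) :
  (forall i j, f x i j @[x --> F] --> A i j) -> f x @[x --> F] --> A.
Proof.
move=> fA; apply/cvg_ballP => e e0.
have : \forall x \near F, forall i j, ball (A i j) e (f x i j).
  apply: filter_forall => i; apply: filter_forall => j.
  by have /cvg_ballP := fA i j; apply.
exact: filterS.
Qed.

Lemma mulmx_continuous (R : realType) m n p :
  continuous (fun q : 'M[R]_(m, n) * 'M[R]_(n, p) => q.1 *m q.2).
Proof.
move=> q; apply: cvg_mx => i j.
under eq_fun do rewrite mxE.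
rewrite mxE.
apply: cvg_big; first exact: add_continuous.
move=> k _; apply: cvgM.
  exact: (continuous_comp (@cvg_fst _ _ _ _ _) (@coord_continuous _ _ _ _ _ _)).
exact: (continuous_comp (@cvg_snd _ _ _ _ _) (@coord_continuous _ _ _ _ _ _)).
Qed.

(** * Derivatives of curves and images of tangent vectors *)

Section tangent.
Context {R : realType}.
Implicit Types V W : normedModType R.

Lemma fst_continuous V W : continuous (@fst V W).
Proof. by move=> ?; exact: cvg_fst. Qed.

Lemma snd_continuous V W : continuous (@snd V W).
Proof. by move=> ?; exact: cvg_snd. Qed.

Lemma is_derive_differentiable V (c : R -> V) (t : R) v :
  is_derive t (1 : R) c v -> differentiable c t.
Proof. by move=> dc; apply/derivable1_diffP. Qed.

Lemma is_derive_comp_linear V W (c : R -> V) (L : {linear V -> W}) (t : R) v :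
  continuous L -> is_derive t (1 : R) c v -> is_derive t (1 : R) (L \o c) (L v).
Proof.
move=> cL dc; have df := is_derive_differentiable dc.
apply: DeriveDef.
  apply/derivable1_diffP; apply: differentiable_comp => //.
  exact: linear_differentiable.
by rewrite derive_comp_linear// derive_val.
Qed.

Lemma is_derive_pair V W (f : R -> V) (g : R -> W) (t : R) df dg :
  is_derive t (1 : R) f df -> is_derive t (1 : R) g dg ->
  is_derive t (1 : R) (fun s => (f s, g s)) (df, dg).
Proof.
move=> f' g'.
have fd := is_derive_differentiable f'; have gd := is_derive_differentiable g'.
apply: DeriveDef; first exact/derivable1_diffP/differentiable_pair.
by rewrite derive_pair// !derive_val.
Qed.

Lemma is_derive_mulmx m n p (f : R -> 'M[R]_(m, n)) (g : R -> 'M[R]_(n, p))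
    (t : R) df dg :
  is_derive t (1 : R) f df -> is_derive t (1 : R) g dg ->
  is_derive t (1 : R) (fun s => f s *m g s) (f t *m dg + df *m g t).
Proof.
move=> f' g'.
have fd := is_derive_differentiable f'; have gd := is_derive_differentiable g'.
have mc := @mulmx_continuous R m n p.
apply: DeriveDef.
  exact/derivable1_diffP/(differentiable_bilinear (B := @mulmx R m n p)).
by rewrite (derive_bilinear (B := @mulmx R m n p))// !derive_val.
Qed.

Lemma is_derive_line V (a v : V) (t : R) :
  is_derive t (1 : R) (fun s => a + s *: v) v.
Proof.
have dv : is_derive t (1 : R) (fun s : R => s *: v) v.
  apply: DeriveDef; first by apply/derivable1_diffP; exact: ex_diff.
  by rewrite deriveE; [rewrite diff_val scale1r|exact: ex_diff].
by apply: is_derive_eq (is_deriveD (is_derive_cst a t 1) dv) _; rewrite add0r.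
Qed.

(** A curve in [N] with velocity [v] is carried by [L] to a curve in [N'] with velocity [L v]. It is
    used for the projection of M to Gr and for the embedding of Gr in M. *)
Lemma tangent_space_linear V W (N : set V) (N' : set W) (L : {linear V -> W})
    x v :
  continuous L -> (forall y, N y -> N' (L y)) ->
  tangent_space N x v -> tangent_space N' (L x) (L v).
Proof.
move=> cL NN' [e [c [e0 sc Nc c0 dc]]]; exists e, (L \o c); split => //.
- by move=> k; apply: class_C_comp_linear (sc k) => //; exact: interval_open.
- by move=> t te; apply/NN'/Nc.
- by rewrite /= c0.
- exact: is_derive_comp_linear.
Qed.

End tangent.

(** * Tangent vectors of the desingularization and smoothness of R *)

Section desingularization.
Context {R : realType} {m n r : nat}.
Implicit Types (X : 'M[R]_(m, n)) (P : 'M[R]_n).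
Local Notation G := (Gr R n (n - r)).
Local Notation M := (desing R m n r).

Lemma tangent_desing_snd x v : tangent_space M x v -> tangent_space G x.2 v.2.
Proof.
apply: (tangent_space_linear (L := snd)); first exact: snd_continuous.
by move=> y [].
Qed.

Lemma tangent_desing0 P dP : tangent_space G P dP ->
  tangent_space M (0, P) (0, dP).
Proof.
(* This linear embedding sends Gr into M, since 0 P = 0. *)
pose f P := (0 : 'M[R]_(m, n), P).
have lf : linear f.
  by move=> a u v; rewrite /f; congr (_, _); rewrite /= scaler0 addr0.
pose fL : {linear _ -> _} := HB.pack f (GRing.isLinear.Build _ _ _ _ _ lf).
have cf : continuous fL.
  move=> Q; apply: differentiable_continuous.
  have d1 : differentiable (fun=> 0 : 'M[R]_(m, n)) Q by exact: differentiable_cst.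
  have d2 : differentiable (@id 'M[R]_n) Q by exact: ex_diff.
  exact: (differentiable_pair d1 d2).
apply: (tangent_space_linear (x := P) (v := dP) cf) => Q GQ.
by split => //=; rewrite mul0mx.
Qed.

Lemma tangent_desing_eq X P dX dP : tangent_space M (X, P) (dX, dP) ->
  dX *m P + X *m dP = 0.
Proof.
move=> [e [c [e0 _ Mc c0 dc]]].
have d1 : is_derive (0 : R) (1 : R) (fst \o c) dX.
  exact: (is_derive_comp_linear (L := fst) (@fst_continuous _ _ _) dc).
have d2 : is_derive (0 : R) (1 : R) (snd \o c) dP.
  exact: (is_derive_comp_linear (L := snd) (@snd_continuous _ _ _) dc).
have := derive_val (is_derive := is_derive_mulmx d1 d2).
rewrite /= c0 /= addrC => <-.
(* The product of the two components of [c] is known to vanish only on ]-e, e[, a neighbourhood of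
   0, which is enough for its derivative at 0. *)
rewrite (near_eq_derive (g := cst 0)) ?derive_cst//.
near=> t; have [] // := Mc t.
near: t; apply: near_in_itvoo; rewrite in_itv/= e0 oppr_lt0 e0//.
Unshelve. all: by end_near. Qed.

Lemma smooth_desing_map RGr :
  smooth_map (tangent_bundle G) G RGr ->
  smooth_map (tangent_bundle M) M (desing_map RGr).
Proof.
have TG X P dX dP : tangent_bundle M ((X, P), (dX, dP)) ->
    tangent_bundle G (P, dP).
  by move=> [[GP _] T]; split=> //; exact: tangent_desing_snd T.
move=> [RG sR]; split=> [[[X P] [dX dP]] /TG/RG GR|[[X P] [dX dP]] /TG/sR].
  (* The value lies in M because the new projection is idempotent: (I - Pbar) Pbar = 0. *)
  split=> //=; rewrite -mulmxA mulmxBl mul1mx.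
  by case: GR => _ -> _; rewrite subrr mulmx0.
pose E := (('M[R]_(m, n) * 'M[R]_n) * ('M[R]_(m, n) * 'M[R]_n))%type.
pose pr (z : E) := (z.1.2, z.2.2).
have lpr : linear pr by [].
pose L : {linear E -> ('M[R]_n * 'M[R]_n)%type} :=
  HB.pack pr (GRing.isLinear.Build _ _ _ _ _ lpr).
have cL : continuous L.
  move=> z; apply: differentiable_continuous.
  have d1 : differentiable (fun z : E => z.1.2) z.
    apply: (linear_differentiable (f := snd \o fst)) => y.
    by apply: continuous_comp; [exact: fst_continuous|exact: snd_continuous].
  have d2 : differentiable (fun z : E => z.2.2) z.
    apply: (linear_differentiable (f := snd \o snd)) => y.
    by apply: continuous_comp; exact: snd_continuous.
  exact: (differentiable_pair d1 d2).
move=> [U [g [[oU Ux] sg gR]]].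
have oLU : open (L @^-1` U) by apply: open_comp => // ? _; exact: cL.
(* The local extension of R is its own formula with R^Gr replaced by the local extension [g], pulled
   back along the projection [L] that forgets X and dX. *)
exists (L @^-1` U), (fun z => ((z.1.1 + z.2.1) *m (1%:M - g (L z)), g (L z))).
split=> //.
- move=> k.
  have Cg : class_C k (L @^-1` U) (g \o L) by exact: class_C_precomp_linear.
  apply: class_C_pair => //.
  apply: (class_C_bilinear (B := @mulmx R m n n)) => //.
  + exact: mulmx_continuous.
  + apply: (class_CD (f := fst \o fst) (g := fst \o snd)) => //.
      apply: (@class_C_linear _ E _ _ _ (fst \o fst)) => z.
      by apply: continuous_comp; exact: fst_continuous.
    apply: (@class_C_linear _ E _ _ _ (fst \o snd)) => z.
    by apply: continuous_comp; [exact: snd_continuous|exact: fst_continuous].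
  + apply: (class_CD (f := fun=> 1%:M) (g := -%R \o (g \o L))) => //.
      exact: class_C_cst.
    apply: (class_C_comp_linear (L := -%R)) => //.
    exact: opp_continuous.
(* [g] agrees with R^Gr only on the tangent bundle of Gr, and [TG] places the projected point
   there. *)
- by move=> [[X' P'] [dX' dP']] [/TG T ?]; rewrite /= gR.
Qed.

End desingularization.

Theorem proposition2p9 (R : realType) (m n r : nat)
    (hm : (0 < m)%N) (hn : (0 < n)%N) (hr : (0 < r)%N) (hrmn : (r < minn m n)%N)
    (RGr : 'M[R]_n * 'M[R]_n -> 'M[R]_n)
    (hRGr : smooth_map (tangent_bundle (Gr R n (n - r))) (Gr R n (n - r)) RGr) :
  is_retraction (desing R m n r) (desing_map (m := m) RGr) <->
  is_retraction (Gr R n (n - r)) RGr.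
Proof.
split=> [[_ retr]|[_ retr]]; split=> //.
- move=> P dP GP TP.
  have MP : desing R m n r (0, P) by split => //=; rewrite mul0mx.
  have [] := retr (0, P) (0, dP) MP (tangent_desing0 TP).
  rewrite /desing_map /= => -[_ c0] dc; split => //.
  exact: (is_derive_comp_linear (L := snd) (@snd_continuous _ _ _) dc).
- exact: smooth_desing_map.
- move=> [X P] [dX dP] [GP XP] TXP.
  have TP := tangent_desing_snd TXP.
  have /= [q0 dq] := retr P dP GP TP.
  split.
    (* At t = 0 the first component is X (I - P), which is X because X P = 0. *)
    by rewrite /desing_map /= q0 scale0r addr0 mulmxBr mulmx1 XP subr0.
  have db : is_derive (0 : R) (1 : R) (fun t : R => 1%:M - RGr (P, t *: dP)) (- dP).
    by apply: is_derive_eq; rewrite sub0r.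
  apply: is_derive_eq
    (is_derive_pair (is_derive_mulmx (is_derive_line X dX 0) db) dq) _.
  (* The product rule gives X (- dP) + dX (I - P), regrouped as dX - (X dP + dX P) so that the
     tangency equation cancels the bracket. *)
  rewrite q0 scale0r addr0 mulmxBr mulmx1 mulmxN addrCA -opprD.
  by rewrite [X *m _ + _]addrC (tangent_desing_eq TXP) subr0.
Qed.
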